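(* There exist absolute constants $\delta_0 > 0$ and $C > 0$ such that the following holds. Let $N \geq 1$ be an integer, let $x_1, \dots, x_N \in \mathbb{T}$ and let $0 < \delta \leq \delta_0$. Suppose that $$ \frac{1}{N} \# \left\{ (m,n) : 1 \leq m, n \leq N,\ m \neq n,\ |x_m - x_n| \leq \frac{s}{N} \right\} \leq (1+\delta)\,2s \qquad \text{for all real } s \text{ with } 1 \leq s \leq \frac{8}{\delta}\sqrt{\log N}. $$ Then $$ \sum_{\substack{k \in \mathbb{Z},\ k \neq 0 \\ |k| \leq \delta^{3/2} N}} \left| \sum_{n=1}^{N} e^{2 \pi i k x_n} \right|^2 \leq C\, \delta N^2 . $$
   Context: $\mathbb{T} = \mathbb{R}/\mathbb{Z}$ is the one-dimensional torus, identified with $[0,1]$ with endpoints glued. For $x,y \in \mathbb{T}$, $|x-y|$ denotes the distance on the torus, i.e. the distance from $x-y$ to the nearest integer. Pairs $(m,n)$ are ordered, and points are counted by index. $\log$ is the natural logarithm. *)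

(* Defs.v *)
From mathcomp Require Export all_boot all_order all_algebra.
From mathcomp Require Export all_classical all_reals all_analysis.
From mathcomp Require Export complex.

Set Implicit Arguments.
Unset Strict Implicit.
Unset Printing Implicit Defensive.

Import Order.TTheory GRing.Theory Num.Theory.

Local Open Scope classical_set_scope.
Local Open Scope ring_scope.

(* A point of the torus R/Z is given by an arbitrary real representative; torus_dist,
   pair_count and exp_sum depend on representatives only modulo the integers. *)

(* Distance from x - y to the nearest integer; the infimum is attained. *)
Definition torus_dist (R : realType) (x y : R) : R :=
  inf [set `|x - y - k%:~R| | k in [set: int]].

Definition expi (R : realType) (t : R) : R[i] := (cos t +i* sin t)%C.

(* The number of ordered pairs of distinct indices whose points are within
   distance r; repeated points are counted with multiplicity. *)
Definition pair_count (R : realType) (N : nat) (x : 'I_N -> R) (r : R) : nat :=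
  #|[pred p : 'I_N * 'I_N |
      (p.1 != p.2) && (torus_dist (x p.1) (x p.2) <= r)]|.

Definition exp_sum (R : realType) (N : nat) (x : 'I_N -> R) (k : int) : R[i] :=
  \sum_(n < N) expi (2 * pi * k%:~R * x n).

(* Main.v *)
Require Import Defs.
From mathcomp Require Import ring lra zify.

Set Implicit Arguments.
Unset Strict Implicit.
Unset Printing Implicit Defensive.

Import Order.TTheory GRing.Theory Num.Theory.
Import numFieldNormedType.Exports.

Local Open Scope classical_set_scope.
Local Open Scope ring_scope.

(** Let h be the indicator function of an interval of length w = 1/(delta N).
The autocorrelation of h is a triangle function, an average of indicators of
[-r, r] over r <= w, so the hypothesis bounds the L^2 norm of sum_n h(. - x_n)
up to a relative error O(delta).  By Parseval this norm also equals
sum_k |h^(k)|^2 |S_k|^2, whose term k = 0 is exactly the main term; for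
|k| <= delta N / 16 the factor |h^(k)| is at least h^(0) / 2, so what is left
controls the exponential sums.  Integrals are avoided by working on Z/MZ with
M = A L, A about delta N and L large: the interval becomes {0, ..., L - 1} and
x_n is replaced by floor(M x_n) / M, at the cost of an error that vanishes as L
grows.  A window of length 1/(delta N) needs pair counts for s <= 1/delta only,
and yields the bound for |k| <= delta N / 16, which contains the range
|k| <= delta^(3/2) N when delta <= 1/256. *)

(** * Lipschitz bounds and orthogonality of cosines on Z/MZ *)

Lemma ler_dist_cos (R : realType) (u v : R) : `|cos u - cos v| <= `|u - v|.
Proof.
wlog uv : u v / v <= u => [hw|].
  by case: (leP v u) => [|/ltW] /hw //; rewrite distrC (distrC v).
have [|c _ ->] := @MVT_segment R cos (fun x => - sin x) v u uv.
  exact/continuous_subspaceT/continuous_cos.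
by rewrite normrM ler_piMl// normrN sin_max.
Qed.

Lemma ler_dist_sin (R : realType) (u v : R) : `|sin u - sin v| <= `|u - v|.
Proof.
rewrite -!cosBpihalf; have -> : u - v = u - pi / 2 - (v - pi / 2) by ring.
exact: ler_dist_cos.
Qed.

(* Multiplying by 2 sin (pi r / M), r = d mod M, makes the sum telescope. *)
Lemma sum_cos_eq0 (R : realType) (M d : nat) : ~~ (M %| d)%N ->
  \sum_(k < M) cos (2 * pi * k%:R * d%:R / M%:R) = 0 :> R.
Proof.
have [->|M0] := posnP M; first by rewrite big_ord0.
move=> Md.
have M0R : (M%:R != 0 :> R) by rewrite pnatr_eq0 -lt0n.
pose r := (d %% M)%N.
have r0 : (0 < r)%N by rewrite lt0n.
have rM : (r < M)%N by rewrite ltn_mod.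
under eq_bigr => k _.
  have -> : 2 * pi * k%:R * d%:R / M%:R
    = 2 * pi * k%:R * r%:R / M%:R + pi *+ 2 *+ (k * (d %/ M))%N :> R.
    rewrite {1}(divn_eq d M) -/r -[pi *+ 2]mulr_natl -[_ *+ (_ * _)]mulr_natl.
    by rewrite !natrD !natrM; field.
  rewrite (periodicn (@cosD2pi R)); over.
pose a : R := pi * r%:R / M%:R.
have a0 : sin a != 0.
  apply/lt0r_neq0/sin_gt0_pi; rewrite /a divr_gt0 ?mulr_gt0 ?pi_gt0 ?ltr0n//=.
  by rewrite ltr_pdivrMr ?ltr0n// ltr_pM2l ?pi_gt0// ltr_nat.
apply: (mulfI a0); rewrite mulr0; apply: (@mulfI _ 2) => //; rewrite mulr0.
have tele n : 2 * (sin a * \sum_(k < n) cos (2 * pi * k%:R * r%:R / M%:R))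
    = sin (2 * n%:R * a - a) + sin a.
  elim: n => [|n IH]; first by rewrite big_ord0 !mulr0 !mul0r sub0r sinN addNr.
  rewrite big_ord_recr /= mulrDr mulrDr IH.
  have -> : 2 * pi * n%:R * r%:R / M%:R = 2 * n%:R * a by rewrite /a; field.
  have -> : 2 * n.+1%:R * a - a = 2 * n%:R * a + a by rewrite -natr1; ring.
  by rewrite sinB sinD; ring.
rewrite tele.
(* The telescoped sum runs over [r] full turns, so its two ends cancel. *)
have -> : 2 * M%:R * a - a = - a + pi *+ 2 *+ r.
  by rewrite -[pi *+ 2]mulr_natl -[_ *+ r]mulr_natl /a; field.
by rewrite (periodicn (@sinD2pi R)) sinN addNr.
Qed.

(** * Squared moduli of exponential sums and the discrete Parseval identity *)

(* The real form of |\sum_i exp (i t_i)|^2. *)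
Definition sqmod (R : realType) (I : finType) (t : I -> R) : R :=
  (\sum_i cos (t i)) ^+ 2 + (\sum_i sin (t i)) ^+ 2.

Lemma sqmod_ge0 (R : realType) (I : finType) (t : I -> R) : 0 <= sqmod t.
Proof. by rewrite addr_ge0// sqr_ge0. Qed.

Lemma eq_sqmod (R : realType) (I : finType) (t u : I -> R) :
  t =1 u -> sqmod t = sqmod u.
Proof. by move=> tu; congr (_ ^+ 2 + _ ^+ 2); apply: eq_bigr => i _; rewrite tu. Qed.

Lemma sqmodE (R : realType) (I : finType) (t : I -> R) :
  sqmod t = \sum_i \sum_j cos (t i - t j).
Proof.
rewrite /sqmod !expr2 !big_distrlr -big_split; apply: eq_bigr => i _ /=.
by rewrite -big_split; apply: eq_bigr => j _; rewrite cosB.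
Qed.

Lemma sqmodN (R : realType) (I : finType) (t : I -> R) :
  sqmod (fun i => - t i) = sqmod t.
Proof.
rewrite !sqmodE exchange_big; apply: eq_bigr => i _; apply: eq_bigr => j _.
by rewrite opprK addrC.
Qed.

Lemma sqmod0 (R : realType) (I : finType) :
  sqmod (fun _ : I => 0 : R) = #|I|%:R ^+ 2.
Proof.
by rewrite /sqmod cos0 sin0 sumr_const big1_eq expr0n addr0.
Qed.

(** An exponential sum over a product index set factors. This separates the window, with its
    explicit sum, from the points. *)
Lemma sqmod_prod (R : realType) (I J : finType) (t : I -> R) (u : J -> R) :
  sqmod (fun p : I * J => t p.1 + u p.2) = sqmod t * sqmod u.
Proof.
rewrite /sqmod.
set c1 := \sum_i cos (t i); set s1 := \sum_i sin (t i).
set c2 := \sum_i cos (u i); set s2 := \sum_i sin (u i).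
have -> : \sum_p cos (t p.1 + u p.2) = c1 * c2 - s1 * s2.
  rewrite -(pair_bigA _ (fun i j => cos (t i + u j))) /c1 /s1 /c2 /s2.
  rewrite !big_distrlr -sumrB; apply: eq_bigr => i _ /=.
  by rewrite -sumrB; apply: eq_bigr => j _; rewrite cosD.
have -> : \sum_p sin (t p.1 + u p.2) = s1 * c2 + c1 * s2.
  rewrite -(pair_bigA _ (fun i j => sin (t i + u j))) /c1 /s1 /c2 /s2.
  rewrite !big_distrlr -big_split; apply: eq_bigr => i _ /=.
  by rewrite -big_split; apply: eq_bigr => j _; rewrite sinD.
ring.
Qed.

(** Since cosine and sine are 1-Lipschitz, each of the two sums moves by at most [#|I| * e]; each
    contributes half of the error term. *)
Lemma sqmod_perturb (R : realType) (I : finType) (t u : I -> R) (e : R) :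
  (forall i, `|t i - u i| <= e) ->
  sqmod t <= 2 * sqmod u + 4 * (#|I|%:R * e) ^+ 2.
Proof.
move=> tu.
have perturb (f : R -> R) : (forall a b, `|f a - f b| <= `|a - b|) ->
    (\sum_i f (t i)) ^+ 2
      <= 2 * (\sum_i f (u i)) ^+ 2 + 2 * (#|I|%:R * e) ^+ 2.
  move=> fl; set a := \sum_i f (t i); set b := \sum_i f (u i).
  have : `|a - b| <= #|I|%:R * e.
    rewrite -sumrB; apply: le_trans (ler_norm_sum _ _ _) _.
    rewrite mulr_natl -sumr_const; apply: ler_sum => i _.
    exact: le_trans (fl _ _) (tu i).
  move=> h; have : (a - b) ^+ 2 <= (#|I|%:R * e) ^+ 2.
    by rewrite -[leLHS]real_normK ?num_real// lerXn2r// nnegrE ?(le_trans _ h).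
  (* This square is the difference of the two sides of a^2 <= 2 b^2 + 2 (a - b)^2. *)
  have := sqr_ge0 (a - 2 * b); nra.
have := perturb cos (@ler_dist_cos R); have := perturb sin (@ler_dist_sin R).
rewrite /sqmod; lra.
Qed.

(** Phases within 1/2 of 0 have cosine at least 1/2, so there is no cancellation. *)
Lemma sqmod_ge (R : realType) (I : finType) (t : I -> R) :
  (forall i, `|t i| <= 2^-1) -> (#|I|%:R / 2) ^+ 2 <= sqmod t.
Proof.
move=> t2; apply: (@le_trans _ _ ((\sum_i cos (t i)) ^+ 2)).
  rewrite lerXn2r ?nnegrE ?sumr_ge0 ?divr_ge0// => [i _|].
    by have := ler_dist_cos (t i) 0; rewrite cos0 subr0 ler_norml; have := t2 i; lra.
  rewrite mulr_natl -sumr_const; apply: ler_sum => i _.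
  by have := ler_dist_cos (t i) 0; rewrite cos0 subr0 ler_norml; have := t2 i; lra.
by rewrite lerDl sqr_ge0.
Qed.

(** After expanding into cosines of differences and summing over [k] first, orthogonality leaves
    only the pairs congruent mod [M], each contributing [M]. *)
Lemma sqmod_parseval (R : realType) (I : finType) (M : nat) (z : I -> int) :
  (0 < M)%N ->
  \sum_(k < M) sqmod (fun i => 2 * pi * k%:R * (z i)%:~R / M%:R)
  = M%:R * #|[pred p : I * I | (M %| z p.1 - z p.2)%Z]|%:R :> R.
Proof.
move=> M0; under eq_bigr do rewrite sqmodE pair_bigA.
rewrite exchange_big /= -sum1_card natr_sum mulr_sumr [RHS]big_mkcond /=.
apply: eq_bigr => -[i j] _ /=; rewrite inE/= mulr1; set d := z i - z j.
have M0R : (M%:R != 0 :> R) by rewrite pnatr_eq0 -lt0n.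
transitivity (\sum_(k < M) cos (2 * pi * k%:R * `|d|%N%:R / M%:R : R)).
  apply: eq_bigr => k _.
  have -> : 2 * pi * k%:R * (z i)%:~R / M%:R - 2 * pi * k%:R * (z j)%:~R / M%:R
      = 2 * pi * k%:R * d%:~R / M%:R :> R by rewrite /d intrD intrN; field.
  rewrite natr_absz; have [//|d0] := leP 0 d; first by move=> ?; rewrite ger0_norm.
  by rewrite ltr0_norm// intrN mulrN mulNr cosN.
rewrite dvdzE; case: ifPn => [/dvdnP[q ->]|]; last exact: sum_cos_eq0.
transitivity (\sum_(k < M) 1 : R); last by rewrite sumr_const card_ord.
apply: eq_bigr => k _; rewrite -[RHS](cos0 R) -[RHS](periodicn (@cosD2pi R) (k * q) 0).
by congr cos; rewrite add0r -[pi *+ 2]mulr_natl -[RHS]mulr_natl !natrM; field.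
Qed.

(** * Coincidences modulo M and pair counts *)

(* Since 2 L <= M, a solution (a, b) is determined by max (a, b). *)
Lemma card_cong_le (L M : nat) (e : int) (P : pred 'I_L) : (2 * L <= M)%N ->
  (forall a b : 'I_L, (M %| a%:Z - b%:Z + e)%Z -> P (if a <= b then b else a)%N) ->
  (#|[pred p : 'I_L * 'I_L | (M %| (p.1%:Z - p.2%:Z + e)%R)%Z]| <= #|P|)%N.
Proof.
move=> LM HP; set D := [pred p | _].
have inj : {in D &, injective (fun p : 'I_L * 'I_L =>
    if (p.1 <= p.2)%N then p.2 else p.1)}.
  move=> [a b] [a' b']; rewrite !inE /= => h h' /(congr1 val) /=.
  have := rpredB h h'; have -> : a%:Z - b%:Z + e - (a'%:Z - b'%:Z + e)
    = (a%:Z - b%:Z) - (a'%:Z - b'%:Z) by lia.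
  case/dvdzP => q qE.
  have := ltn_ord a; have := ltn_ord b; have := ltn_ord a'; have := ltn_ord b'.
  move=> lb' la' lb la.
  (* Both differences are at most L - 1 in absolute value, so the multiple [q * M] has size at most
     2 L - 2 < M. *)
  have q0 : q = 0.
    nia.
  move: qE; rewrite q0 mul0r => qE mE.
  have [aa bb] : a = a' :> nat /\ b = b' :> nat.
    by move: mE; case: ifP; case: ifP; lia.
  by congr (_, _); exact: val_inj.
rewrite -(card_in_imset inj); apply: subset_leq_card.
by apply/fintype.subsetP => r /imsetP[[a b]]; rewrite inE/= => /HP ? ->.
Qed.

Lemma torus_dist_le (R : realType) (x y : R) (q : int) :
  torus_dist x y <= `|x - y - q%:~R|.
Proof.
by apply: ge_inf; [exists 0 => _ [k _ <-]; exact: normr_ge0 | exists q].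
Qed.

Lemma pair_countE (R : realType) (N : nat) (x : 'I_N -> R) (r : R) :
  pair_count x r
  = (\sum_m \sum_n ((m != n) && (torus_dist (x m) (x n) <= r)%R : bool))%N.
Proof.
rewrite /pair_count -sum1_card pair_bigA [LHS]big_mkcond /=.
by apply: eq_bigr => p _; rewrite inE; case: ifP.
Qed.

Lemma le_pair_count (R : realType) (N : nat) (x : 'I_N -> R) (r s : R) :
  r <= s -> (pair_count x r <= pair_count x s)%N.
Proof.
move=> rs; apply: subset_leq_card; apply/fintype.subsetP => p.
by rewrite !inE => /andP[-> /= h]; apply: le_trans rs.
Qed.

(** For fixed m and n, [card_cong_le] indexes the coincidences by r = max (a, b), and each forces
    x_m and x_n within (r + 1) / M. This is the triangle function as a sum of indicators; the
    diagonal m = n gives [N * L]. *)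
Lemma card_coincidences (R : realType) (N : nat) (x : 'I_N -> R) (L M : nat)
    (z := fun p : 'I_L * 'I_N => p.1%:Z + Num.floor (M%:R * x p.2)) :
  (0 < M)%N -> (2 * L <= M)%N ->
  (#|[pred p : ('I_L * 'I_N) * ('I_L * 'I_N) | (M %| (z p.1 - z p.2)%R)%Z]|
    <= N * L + \sum_(r < L) pair_count x (r.+1%:R / M%:R))%N.
Proof.
move=> M0 LM.
have M0R : 0 < M%:R :> R by rewrite ltr0n.
pose y n := Num.floor (M%:R * x n).
pose P m n (r : 'I_L) :=
  (m == n) || (torus_dist (x m) (x n) <= r.+1%:R / M%:R).
apply: (@leq_trans (\sum_m \sum_n #|P m n|)); last first.
  rewrite (eq_bigr (fun m => L + \sum_(n | n != m) #|P m n|)%N); last first.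
    move=> m _; rewrite (bigD1 m)//=; congr addn.
    by rewrite -[RHS]card_ord; apply: eq_card => r; rewrite unfold_in/P eqxx.
  rewrite big_split/= sum_nat_const card_ord leq_add2l.
  under [leqRHS]eq_bigr do rewrite pair_countE.
  rewrite exchange_big /=; apply: leq_sum => m _.
  rewrite exchange_big /= big_mkcond /=; apply: leq_sum => n _.
  rewrite eq_sym; case: ifP => // mn.
  rewrite -sum1_card big_mkcond/=; apply: leq_sum => r _.
  by rewrite unfold_in/P (negbTE mn).
have -> : #|[pred p : ('I_L * 'I_N) * ('I_L * 'I_N) |
      (M %| (z p.1 - z p.2)%R)%Z]|
   = (\sum_m \sum_n #|[pred p : 'I_L * 'I_L |
      (M %| (p.1%:Z - p.2%:Z + (y m - y n))%R)%Z]|)%N.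
  pose F a m b n : nat := (M %| (a%:Z - b%:Z + (y m - y n))%R)%Z.
  transitivity (\sum_(a < L) \sum_m \sum_(b < L) \sum_n F a m b n)%N.
    rewrite pair_bigA -sum1_card big_mkcond /=.
    rewrite -(pair_bigA _ (fun p q : 'I_L * 'I_N =>
      if (M %| z p - z q)%Z then 1%N else 0%N))/=.
    apply: eq_bigr => -[a m] _; rewrite [RHS]pair_bigA; apply: eq_bigr => -[b n] _.
    by rewrite /F /z /= opprD addrACA /y; case: ifP.
  rewrite exchange_big /=; apply: eq_bigr => m _.
  under eq_bigr do rewrite exchange_big /=.
  rewrite exchange_big /=; apply: eq_bigr => n _.
  rewrite pair_bigA -sum1_card [RHS]big_mkcond /=; apply: eq_bigr => p _.
  by rewrite /F inE /=; case: ifP.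
apply: leq_sum => m _; apply: leq_sum => n _.
apply: card_cong_le => // a b /dvdzP[q qE]; rewrite /P.
case: eqVneq => //= _.
(* The quotient [q] is the nearby integer: after scaling by [M], |a - b| is at most the maximum and
   the two floors cost less than 1, whence [r.+1]. *)
apply: le_trans (torus_dist_le _ _ q) _.
rewrite ler_pdivlMr// -[X in _ * X]gtr0_norm// -normrM.
have /(congr1 (fun i : int => i%:~R : R)) := qE.
rewrite !(intrD, intrM, intrN) => {}qE.
have := floor_itv (M%:R * x m); have := floor_itv (M%:R * x n).
rewrite !intrD -!/(y _) => /andP[m1 m2] /andP[n1 n2].
rewrite ler_norml.
have : (a%:R <= (if (a <= b)%N then b else a)%:R :> R)
    /\ (b%:R <= (if (a <= b)%N then b else a)%:R :> R).
  by rewrite !ler_nat; case: ifP; lia.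
rewrite -natr1 => -[]; set c : R := _%:R => ac bc.
have a0 : 0 <= a%:R :> R by []; have b0 : 0 <= b%:R :> R by [].
move: qE; rewrite !pmulrn => qE.
apply/andP; split; lra.
Qed.

(* The subtracted square is the frequency k = 0. *)
Lemma sum_sqmod_le (R : realType) (N : nat) (x : 'I_N -> R) (L M K : nat) :
  (2 * L <= M)%N -> (K < M)%N ->
  \sum_(1 <= k < K.+1)
      sqmod (fun a : 'I_L => 2 * pi * k%:R * a%:R / M%:R) *
      sqmod (fun n => 2 * pi * k%:R * (Num.floor (M%:R * x n))%:~R / M%:R)
  <= M%:R * (N%:R * L%:R + \sum_(r < L) (pair_count x (r.+1%:R / M%:R))%:R)
     - (L%:R * N%:R) ^+ 2 :> R.
Proof.
move=> LM KM; have M0 : (0 < M)%N by apply: leq_trans KM.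
pose z p := (p.1 : 'I_L)%:Z + Num.floor (M%:R * x p.2).
pose f k : R := sqmod (fun p => 2 * pi * k%:R * (z p)%:~R / M%:R).
have f0 k : 0 <= f k by exact: sqmod_ge0.
(* Parseval needs all [M] frequencies; those above [K] are discarded by positivity. *)
rewrite lerBrDr; apply: (@le_trans _ _ (\sum_(k < M) f k)); last first.
  rewrite sqmod_parseval// ler_wpM2l// -natrM -natr_sum -natrD ler_nat.
  exact: card_coincidences.
rewrite -(big_mkord xpredT f) (big_cat_nat (leq0n 1))//= big_nat1.
rewrite addrC lerD//; last first.
  rewrite (_ : f 0%N = sqmod (fun _ : 'I_L * 'I_N => 0)).
    by rewrite sqmod0 card_prod !card_ord natrM.
  by apply: eq_sqmod => p; rewrite mulr0 !mul0r.
rewrite [leRHS](big_cat_nat (n := K.+1))//= ler_wpDr ?sumr_ge0//.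
apply: ler_sum => k _; rewrite -sqmod_prod le_eqVlt; apply/orP; left; apply/eqP.
apply: eq_sqmod => p /=; rewrite /z intrD -pmulrn; ring.
Qed.

(** * Numerical bounds and use of the pair correlation hypothesis *)

Lemma pi_lt4 (R : realType) : pi < 4 :> R.
Proof. by have := @pihalf_lt2 R; lra. Qed.

(** This makes the admissible range of s reach 1 / delta. *)
Lemma sqrt_ln_ge (R : realType) (N : nat) : (2 <= N)%N ->
  8^-1 <= Num.sqrt (ln N%:R) :> R.
Proof.
move=> N2; rewrite -[leLHS]gtr0_norm// -sqrtr_sqr; apply: ler_wsqrtr.
have : ln 2 <= ln N%:R :> R by rewrite ler_ln ?posrE ?ltr0n ?ler_nat// ltnW.
(* This gives ln 2 >= 1/2, more than the required (1/8)^2. *)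
have : ln (1 + - 2^-1) <= - 2^-1 :> R by apply: le_ln1Dx; lra.
have -> : 1 + - 2^-1 = 2^-1 :> R by field.
rewrite lnV ?posrE//; lra.
Qed.

Lemma sum_ord_succ (R : realType) (L : nat) :
  \sum_(r < L) r.+1%:R = L%:R * (L%:R + 1) / 2 :> R.
Proof.
elim: L => [|L IH]; first by rewrite big_ord0 !mul0r.
by rewrite big_ord_recr /= IH -natr1; field.
Qed.

(** The hypothesis starts at s = 1; below that, monotonicity replaces s by max (s, 1) <= 1 + s. The
    extra 1 only affects lower-order terms. *)
Lemma pair_count_le (R : realType) (N : nat) (x : 'I_N -> R) (delta s : R) :
  0 < delta <= 1 -> (2 <= N)%N ->
  (forall s : R, 1 <= s <= 8 / delta * Num.sqrt (ln N%:R) ->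
    N%:R^-1 * (pair_count x (s / N%:R))%:R <= (1 + delta) * (2 * s)) ->
  0 <= s <= delta^-1 ->
  (pair_count x (s / N%:R))%:R <= 2 * N%:R * (1 + delta) * (1 + s).
Proof.
move=> /andP[d0 d1] N2 paircor /andP[s0 sd].
have N0 : 0 < N%:R :> R by rewrite ltr0n ltnW.
have Sge : delta^-1 <= 8 / delta * Num.sqrt (ln N%:R).
  rewrite mulrAC -[leLHS]mul1r ler_wpM2r ?invr_ge0 ?(ltW d0)//.
  by have := sqrt_ln_ge R N2; lra.
pose t := Num.max s 1.
have t1 : 1 <= t by rewrite le_max lexx orbT.
have td : t <= delta^-1 by rewrite ge_max sd invf_ge1.
have st : s <= t by rewrite le_max lexx.
have ts : t <= 1 + s by rewrite ge_max; apply/andP; split; lra.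
apply: (@le_trans _ _ (pair_count x (t / N%:R))%:R).
  by rewrite ler_nat le_pair_count// ler_wpM2r// invr_ge0 ltW.
have := paircor t; rewrite t1 (le_trans td Sge) => /(_ isT).
rewrite mulrC ler_pdivrMr// => /le_trans; apply.
have -> : (1 + delta) * (2 * t) * N%:R = 2 * N%:R * (1 + delta) * t by ring.
by rewrite ler_wpM2l// !mulr_ge0// ?ltW//; lra.
Qed.

(** * The bound for positive frequencies *)

Lemma sum_sqmod_exp_le (R : realType) (N : nat) (x : 'I_N -> R) (delta : R)
    (K : nat) :
  0 < delta <= 1 -> (2 <= N)%N ->
  (forall s : R, 1 <= s <= 8 / delta * Num.sqrt (ln N%:R) ->
    N%:R^-1 * (pair_count x (s / N%:R))%:R <= (1 + delta) * (2 * s)) ->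
  16 * K%:R <= delta * N%:R -> (0 < K)%N ->
  \sum_(1 <= k < K.+1) sqmod (fun n => 2 * pi * k%:R * x n)
  <= 105 * delta * N%:R ^+ 2.
Proof.
move=> d01 N2 paircor KN K0; have /andP[d0 d1] := d01.
have N0 : 0 < N%:R :> R by rewrite ltr0n ltnW.
have K1 : 1 <= K%:R :> R by rewrite ler1n.
have dN : 16 <= delta * N%:R by lra.
have pi4 := pi_lt4 R; have pi0 := pi_gt0 R.
(* The window has length L / M = 1 / A, which is comparable to 1 / (delta N). *)
pose A := (Num.truncn (delta * N%:R)).+1.
have [A1 A2] : delta * N%:R <= A%:R /\ A%:R <= 2 * (delta * N%:R).
  have /truncn_itv/andP[] : 0 <= delta * N%:R by lra.
  by rewrite -/A -[A%:R]natr1; lra.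
(* With [delta * L >= N], both the off-by-one in L (L + 1) and the rounding of the points cost only
   O(delta). *)
pose L := (Num.truncn (N%:R / delta)).+1.
have L1 : N%:R / delta <= L%:R.
  by have /truncn_itv/andP[_ /ltW] : 0 <= N%:R / delta by rewrite divr_ge0// ltW.
have NdL : N%:R <= delta * L%:R by rewrite mulrC -ler_pdivrMr.
have L0 : 0 < L%:R :> R by rewrite ltr0n.
have A0 : 0 < A%:R :> R by rewrite ltr0n.
have NL : N%:R <= L%:R :> R by nra.
have N1 : 1 <= N%:R :> R by rewrite ler1n ltnW.
pose M := (A * L)%N.
have ME : M%:R = A%:R * L%:R :> R by rewrite natrM.
have M0 : 0 < M%:R :> R by rewrite ME mulr_gt0.
have LM : (2 * L <= M)%N.
  by rewrite leq_mul2r -(ler_nat R); apply/orP; right; lra.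
have KM : (K < M)%N.
  rewrite -(ltr_nat R) ME.
  by have : A%:R <= A%:R * L%:R :> R; [by rewrite ler_peMr ?ler1n// ltW | lra].
(* From pi < 4 and 16 k <= A, the window phases satisfy the condition of [sqmod_ge]. *)
have small k a : (k <= K)%N -> (a <= L)%N ->
    `|2 * pi * k%:R * a%:R / M%:R| <= 2^-1 :> R.
  move=> kK aL; rewrite ger0_norm; last first.
    by rewrite divr_ge0// !mulr_ge0// ltW.
  rewrite ler_pdivrMr// ME.
  have kA : 16 * k%:R <= A%:R :> R by have : k%:R <= K%:R :> R; [rewrite ler_nat | lra].
  have aLR : a%:R <= L%:R :> R by rewrite ler_nat.
  have : 2 * pi * k%:R <= 2^-1 * A%:R :> R.
    have : pi * k%:R <= 4 * k%:R :> R by rewrite ler_wpM2r// ltW.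
    lra.
  move=> h; rewrite mulrA; apply: ler_pM => //.
  by rewrite !mulr_ge0// ltW.
pose v n := Num.floor (M%:R * x n).
pose w k := sqmod (fun n => 2 * pi * k%:R * (v n)%:~R / M%:R) : R.
(* The constant is 4 (10 + 3): 10 from [h4], 3 from [h5], and 4 from the lower bound (L / 2)^2 for
   the window factor. *)
have w_le : \sum_(1 <= k < K.+1) w k <= 52 * delta * N%:R ^+ 2.
  have h := sum_sqmod_le x LM KM.
  have h1 : (L%:R / 2) ^+ 2 * \sum_(1 <= k < K.+1) w k <= \sum_(1 <= k < K.+1)
      sqmod (fun a : 'I_L => 2 * pi * k%:R * a%:R / M%:R) * w k.
    rewrite mulr_sumr big_nat [leRHS]big_nat; apply: ler_sum => k /andP[k1 kK].
    rewrite ler_wpM2r ?sqmod_ge0// -[in X in X <= _](card_ord L).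
    by apply: sqmod_ge => a; rewrite small// ltnW.
  have h2 : \sum_(r < L) (pair_count x (r.+1%:R / M%:R))%:R <=
      2 * N%:R * (1 + delta) * (L%:R + N%:R / M%:R * (L%:R * (L%:R + 1) / 2)) :> R.
    have -> : L%:R + N%:R / M%:R * (L%:R * (L%:R + 1) / 2) =
        \sum_(r < L) (1 + N%:R / M%:R * r.+1%:R) :> R.
      by rewrite big_split/= -mulr_sumr sum_ord_succ sumr_const card_ord.
    rewrite mulr_sumr.
    apply: ler_sum => r _.
    have -> : r.+1%:R / M%:R = (N%:R / M%:R * r.+1%:R) / N%:R :> R.
      by field; rewrite !gt_eqF.
    apply: (pair_count_le d01 N2 paircor).
    rewrite mulr_ge0 ?divr_ge0 ?(ltW M0) ?(ltW N0)//=.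
    rewrite mulrAC ler_pdivrMr// ME.
    have : r.+1%:R <= L%:R :> R by rewrite ler_nat.
    rewrite ler_pdivlMl//; nra.
  have h3 : (L%:R / 2) ^+ 2 * \sum_(1 <= k < K.+1) w k <=
      A%:R * L%:R * (N%:R * L%:R + 2 * N%:R * (1 + delta) * L%:R) +
      N%:R ^+ 2 * (1 + delta) * (L%:R * (L%:R + 1)) - (L%:R * N%:R) ^+ 2 :> R.
    apply: le_trans h1 _; apply: le_trans h _; rewrite lerD2r.
    apply: le_trans (ler_wpM2l (ltW M0) (lerD (lexx _) h2)) _.
    by rewrite le_eqVlt ME; apply/orP; left; apply/eqP; field; rewrite !gt_eqF.
  have dL : 1 <= delta * L%:R by lra.
  have h4 : A%:R * L%:R * (N%:R * L%:R + 2 * N%:R * (1 + delta) * L%:R) <=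
      10 * delta * (N%:R * L%:R) ^+ 2.
    have -> : A%:R * L%:R * (N%:R * L%:R + 2 * N%:R * (1 + delta) * L%:R) =
      A%:R * (3 + 2 * delta) * (N%:R * L%:R ^+ 2) by ring.
    have -> : 10 * delta * (N%:R * L%:R) ^+ 2 =
      2 * (delta * N%:R) * 5 * (N%:R * L%:R ^+ 2) by ring.
    rewrite ler_wpM2r ?mulr_ge0 ?sqr_ge0 ?(ltW N0)//.
    by apply: ler_pM => //; lra.
  (* The leading [(N L)^2] cancels against the subtracted frequency 0, so the sharp factor 1 + delta
     in the hypothesis is essential here. *)
  have h5 : N%:R ^+ 2 * (1 + delta) * (L%:R * (L%:R + 1)) <=
      (N%:R * L%:R) ^+ 2 + 3 * delta * (N%:R * L%:R) ^+ 2.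
    have -> : (N%:R * L%:R) ^+ 2 + 3 * delta * (N%:R * L%:R) ^+ 2 =
      N%:R ^+ 2 * (L%:R * (L%:R + delta * L%:R + 2 * (delta * L%:R))) by ring.
    have -> : N%:R ^+ 2 * (1 + delta) * (L%:R * (L%:R + 1)) =
      N%:R ^+ 2 * (L%:R * (L%:R + delta * L%:R + (1 + delta))) by ring.
    rewrite ler_wpM2l ?sqr_ge0// ler_wpM2l ?(ltW L0)// lerD2l; lra.
  rewrite -(ler_pM2l (exprn_gt0 2 (divr_gt0 L0 (ltr0n R 2)))).
  apply: (le_trans h3); lra.
(* Rounding moves x_n by less than 1 / M, hence the phase by at most 1 / (2 L), by [small] with a =
   L. The total is 2 * 52 + 1 = 105. *)
apply: (@le_trans _ _ (\sum_(1 <= k < K.+1)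
    (2 * w k + (N%:R / L%:R) ^+ 2))).
  rewrite big_nat [leRHS]big_nat; apply: ler_sum => k /andP[k1 kK].
  have kM : 0 <= 2 * pi * k%:R / M%:R :> R.
    by rewrite divr_ge0// ?mulr_ge0// ltW.
  have := @sqmod_perturb R _ (fun n => 2 * pi * k%:R * x n)
    (fun n => 2 * pi * k%:R * (v n)%:~R / M%:R) (2^-1 / L%:R).
  rewrite card_ord -/(w k) => /(_ _)/le_trans; apply.
    move=> n.
    have -> : 2 * pi * k%:R * x n - 2 * pi * k%:R * (v n)%:~R / M%:R =
        2 * pi * k%:R / M%:R * (M%:R * x n - (v n)%:~R).
      by field; rewrite gt_eqF.
    rewrite normrM (ger0_norm kM).
    have /andP[] := floor_itv (M%:R * x n); rewrite -/(v n) intrD => v1 v2.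
    have h : `|M%:R * x n - (v n)%:~R| <= 1 by rewrite ler_norml; lra.
    apply: (le_trans (ler_piMr _ h)) => //.
    rewrite ler_pdivlMr// mulrAC.
    by apply: le_trans (ler_norm _) _; apply: small.
  by rewrite lerD2l le_eqVlt; apply/orP; left; apply/eqP; field; rewrite gt_eqF.
rewrite big_split/= -mulr_sumr sumr_const_nat subn1/= -[X in _ + X]mulr_natl.
have : K%:R * (N%:R / L%:R) ^+ 2 <= delta * N%:R ^+ 2.
  apply: (@le_trans _ _ K%:R).
    rewrite ler_piMr// exprn_ile1 ?divr_ge0 ?(ltW N0) ?(ltW L0)//.
    by rewrite ler_pdivrMr// mul1r.
  have : delta * N%:R <= delta * N%:R ^+ 2.
    by rewrite expr2 mulrA ler_peMr//; lra.
  lra.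
lra.
Qed.

(** * Complex exponential sums, symmetry in k and the conclusion *)

Lemma normc_exp_sum (R : realType) (N : nat) (x : 'I_N -> R) (k : int) :
  Normc.normc (exp_sum x k) ^+ 2 = sqmod (fun n => 2 * pi * k%:~R * x n).
Proof.
rewrite /exp_sum /sqmod.
have -> : \sum_(n < N) expi (2 * pi * k%:~R * x n) =
    ((\sum_(n < N) cos (2 * pi * k%:~R * x n)) +i*
     (\sum_(n < N) sin (2 * pi * k%:~R * x n)))%C.
  by elim: (index_enum _) => [|n s IH]; rewrite ?big_nil// !big_cons IH.
by rewrite /= sqr_sqrtr// addr_ge0 ?sqr_ge0.
Qed.

Lemma fsum_even (R : realType) (g : int -> R) (B : R) : 0 <= B ->
  (forall k, g (- k) = g k) ->
  \sum_(k \in [set k : int | k != 0 /\ `|k|%:~R <= B]) g k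
  = 2 * \sum_(1 <= k < (Num.truncn B).+1) g k%:Z.
Proof.
move=> B0 gN; pose r := index_iota 1 (Num.truncn B).+1.
pose s := [seq k%:Z | k <- r] ++ [seq - k%:Z | k <- r].
have rP k : (k \in r) = (0 < k)%N && (k%:R <= B).
  by rewrite mem_index_iota ltnS truncn_ge_nat.
have -> : [set k : int | k != 0 /\ `|k|%:~R <= B] = [set` s].
  apply/seteqP; split => k /=; rewrite mem_cat.
    rewrite -natr_absz => -[k0 kB].
    have kr : `|k|%N \in r by rewrite rP absz_gt0 k0.
    apply/orP; have [k1|k1] := leP 0 k; [left|right];
      by apply/mapP; exists `|k|%N => //; lia.
  move=> /orP[] /mapP[n]; rewrite rP => /andP[n0 nB] ->.
    by split; [lia | exact: nB].
  by split; [lia | rewrite normrN; exact: nB].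
rewrite -fsbig_seq ?big_cat ?big_map /=.
  by rewrite [X in _ + X](eq_bigr (fun k : nat => g k%:Z))// mulr_natl mulr2n.
rewrite cat_uniq !map_inj_uniq ?iota_uniq ?andbT//=; last 2 first.
- by move=> m n /oppr_inj[].
- by move=> m n [].
apply/hasPn => y /mapP[n]; rewrite rP => /andP[n0 _] ->.
by apply/mapP => -[m]; rewrite rP => /andP[m0 _]; lia.
Qed.

Theorem mainTheorem3 (R : realType) :
  exists delta0 C : R, [/\ 0 < delta0, 0 < C &
    forall (N : nat) (x : 'I_N -> R) (delta : R),
      (1 <= N)%N ->
      0 < delta <= delta0 ->
      (forall s : R, 1 <= s <= 8 / delta * Num.sqrt (ln N%:R) ->
        N%:R^-1 * (pair_count x (s / N%:R))%:R <= (1 + delta) * (2 * s)) ->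
      \sum_(k \in [set k : int | k != 0 /\ `|k|%:~R <= delta `^ (3 / 2) * N%:R])
          Normc.normc (exp_sum x k) ^+ 2
        <= C * delta * N%:R ^+ 2].
Proof.
(* The choice of delta0 gives sqrt delta <= 1/16, hence 16 delta^(3/2) N <= delta N; and 210 = 2 *
   105 counts both signs of k. *)
exists (16^-1 ^+ 2), 210; split => // N x delta N1 /andP[d0 d1] paircor.
have N0 : 0 < N%:R :> R by rewrite ltr0n.
pose B := delta `^ (3 / 2) * N%:R.
have B0 : 0 <= B by rewrite mulr_ge0 ?powR_ge0.
have d2 : delta <= 1 by apply: le_trans d1 _; lra.
have BdN : 16 * B <= delta * N%:R.
  rewrite /B; have -> : 3 / 2 = 1 + 2^-1 :> R by field.
  rewrite mulrA ler_wpM2r ?(ltW N0)// powRD; last by apply/implyP; rewrite gt_eqF.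
  rewrite powRr1 ?(ltW d0)// powR12_sqrt ?(ltW d0)//.
  have := ler_wsqrtr d1; rewrite sqrtr_sqr ger0_norm// => h.
  by rewrite mulrCA ger_pMr//; lra.
rewrite -/B fsum_even//; last first.
  move=> k; rewrite !normc_exp_sum -sqmodN; apply: eq_sqmod => n.
  by rewrite intrN; ring.
pose K := Num.truncn B.
have KB : K%:R <= B by rewrite truncn_le.
rewrite -/K; have [->|K0] := posnP K.
  by rewrite big_geq// mulr0 !mulr_ge0// ltW.
(* A nonempty frequency range gives 16 <= 16 K <= delta N <= N, which keeps log N away from 0. *)
have N2 : (2 <= N)%N.
  have : 1 <= K%:R :> R by rewrite ler1n.
  rewrite -(ler_nat R) => K1.
  have : delta * N%:R <= N%:R by rewrite ler_piMl// ltW.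
  lra.
have := @sum_sqmod_exp_le R N x delta K _ N2 paircor _ K0.
rewrite d0 d2 => /(_ isT) h.
under eq_bigr do rewrite normc_exp_sum.
have -> : 210 * delta * N%:R ^+ 2 = 2 * (105 * delta * N%:R ^+ 2) by ring.
rewrite ler_pM2l//; apply: h; lra.
Qed.
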